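(* Let $K$ be a perfect field of characteristic $2$, and assume that any quadratic equation with coefficients in $K$ has a solution in $K$. Let $\mathscr L$ be the Skryabin algebra over $K$. Then $\mathrm{Aut}(\mathscr L)=\mathrm{Aut}_0(\mathscr L)$; that is, the automorphism group of $\mathscr L$ is generated by the automorphisms $\exp(\alpha c_2)$, $\exp(\alpha c_4)$, $\exp(\alpha c_5)$, $\exp(\alpha c_3^{[2]})$, $\Phi(\alpha)$, $\Psi(\alpha)$, $\Theta(\alpha)$ ($\alpha\in K$) and $\Delta(\lambda)$ ($\lambda\in K^*$).
   Context: The Skryabin algebra $\mathscr L$ is the $15$-dimensional simple Lie algebra over $K$ with basis $\{b_1,\dots,b_9,c_1,\dots,c_5,d\}$ and the following multiplication table (the bracket is alternating, so $[x,x]=0$ and $[x,y]=[y,x]$ in characteristic $2$; every bracket of two distinct basis elements not listed, up to order, is zero): $[b_1,b_2]=b_3$, $[b_1,b_3]=b_1$, $[b_1,b_5]=b_6$, $[b_1,b_6]=b_4$, $[b_1,b_8]=b_9$, $[b_1,b_9]=b_7$, $[b_1,c_1]=d$, $[b_1,c_2]=c_3$, $[b_1,c_3]=c_1$, $[b_1,c_4]=b_2$, $[b_1,c_5]=b_5$; $[b_2,b_3]=b_2$, $[b_2,b_4]=b_6$, $[b_2,b_6]=b_5$, $[b_2,b_7]=b_9$, $[b_2,b_9]=b_8$, $[b_2,c_1]=c_3$, $[b_2,c_3]=c_2$; $[b_3,b_4]=b_4$, $[b_3,b_5]=b_5$, $[b_3,b_7]=b_7$, $[b_3,b_8]=b_8$,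 $[b_3,c_1]=c_1$, $[b_3,c_2]=c_2$; $[b_4,b_7]=d$, $[b_4,b_8]=c_3$, $[b_4,b_9]=c_1$, $[b_4,c_1]=b_3$, $[b_4,c_2]=c_4$, $[b_4,c_3]=b_2$, $[b_4,c_4]=b_5$, $[b_4,d]=b_1$; $[b_5,b_7]=c_3$, $[b_5,b_9]=c_2$, $[b_5,c_1]=c_4$, $[b_5,d]=b_2$; $[b_6,b_7]=c_1$, $[b_6,b_8]=c_2$, $[b_6,c_3]=c_4$, $[b_6,d]=b_3$; $[b_7,c_1]=b_6$, $[b_7,c_2]=c_5$, $[b_7,c_3]=b_5$, $[b_7,c_4]=b_8$, $[b_7,c_5]=c_2$, $[b_7,d]=b_4$; $[b_8,c_1]=c_5$, $[b_8,d]=b_5$; $[b_9,c_3]=c_5$, $[b_9,d]=b_6$; $[c_1,c_3]=b_8$, $[c_1,c_4]=c_2$, $[c_1,d]=b_7$; $[c_2,d]=b_8$; $[c_3,d]=b_9$; $[c_5,d]=c_4$. $\mathrm{Aut}(\mathscr L)$ is the group of $K$-linear Lie algebra automorphisms of $\mathscr L$. $\mathrm{Aut}_0(\mathscr L)$ is the subgroup generated by the following automorphisms, where $\alpha\in K$, $\lambda\in K^*$; for all of them except $\Delta(\lambda)$, basis elements not mentioned are fixed. $\exp(\alpha c_2)=1+\alpha\,\mathrm{ad}\,c_2$: $b_1\mapsto b_1+\alpha c_3$, $b_3\mapsto b_3+\alpha c_2$, $b_4\mapsto b_4+\alpha c_4$, $b_7\mapsto b_7+\alpha c_5$, $d\mapsto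 d+\alpha b_8$. $\exp(\alpha c_4)=1+\alpha\,\mathrm{ad}\,c_4$: $b_1\mapsto b_1+\alpha b_2$, $b_4\mapsto b_4+\alpha b_5$, $b_7\mapsto b_7+\alpha b_8$, $c_1\mapsto c_1+\alpha c_2$. $\exp(\alpha c_5)=1+\alpha\,\mathrm{ad}\,c_5$: $b_1\mapsto b_1+\alpha b_5$, $b_7\mapsto b_7+\alpha c_2$, $d\mapsto d+\alpha c_4$. $\exp(\alpha c_3^{[2]})=1+\alpha(\mathrm{ad}\,c_3)^2$: $b_1\mapsto b_1+\alpha b_8$, $b_4\mapsto b_4+\alpha c_2$, $d\mapsto d+\alpha c_5$. $\Phi(\alpha)$: $b_1\mapsto b_1+\alpha b_4$, $b_2\mapsto b_2+\alpha b_5$, $b_7\mapsto b_7+\alpha^2b_2+\alpha^3b_5+\alpha c_1$, $b_8\mapsto b_8+\alpha c_2$, $b_9\mapsto b_9+\alpha^2c_4$, $c_1\mapsto c_1+\alpha^2b_5$, $c_3\mapsto c_3+\alpha c_4$, $d\mapsto d+\alpha b_3+\alpha^2b_6$. $\Psi(\alpha)$: $b_1\mapsto b_1+\alpha b_6+\alpha c_1+\alpha^2c_4$, $b_2\mapsto b_2+\alpha c_2$, $b_3\mapsto b_3+\alpha b_5$, $b_4\mapsto b_4+\alpha b_2+\alpha^2c_2$, $b_6\mapsto b_6+\alpha c_4$, $b_7\mapsto b_7+\alpha b_5+\alpha c_3$, $b_9\mapsto b_9+\alpha c_2+\alpha c_5$, $c_1\mapsto c_1+\alpha b_8+\alpha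 c_4$, $d\mapsto d+\alpha b_2+\alpha b_9+\alpha^2c_2+\alpha^2c_5$. $\Theta(\alpha)$: $b_1\mapsto b_1+\alpha b_7+\alpha^3b_8+\alpha^2b_9$, $b_2\mapsto b_2+\alpha b_8$, $b_3\mapsto b_3+\alpha^2b_8$, $b_4\mapsto b_4+\alpha^2b_5+\alpha c_1+\alpha^2c_3+\alpha^3c_5$, $b_5\mapsto b_5+\alpha c_2$, $b_6\mapsto b_6+\alpha^2c_2+\alpha^2c_5$, $c_1\mapsto c_1+\alpha^2c_2+\alpha^2c_5$, $c_3\mapsto c_3+\alpha c_5$, $d\mapsto d+\alpha^2b_5+\alpha b_6+\alpha^3c_2+\alpha^2c_3$. $\Delta(\lambda)$: $b_1\mapsto\lambda^{-2}b_1$, $b_2\mapsto\lambda^2b_2$, $b_3\mapsto b_3$, $b_4\mapsto\lambda^{-1}b_4$, $b_5\mapsto\lambda^3b_5$, $b_6\mapsto\lambda b_6$, $b_7\mapsto b_7$, $b_8\mapsto\lambda^4b_8$, $b_9\mapsto\lambda^2b_9$, $c_1\mapsto\lambda c_1$, $c_2\mapsto\lambda^5c_2$, $c_3\mapsto\lambda^3c_3$, $c_4\mapsto\lambda^4c_4$, $c_5\mapsto\lambda^5c_5$, $d\mapsto\lambda^{-1}d$. *)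

(* Defs.v *)
From mathcomp Require Import all_boot all_order all_algebra.

Set Implicit Arguments.
Unset Strict Implicit.
Unset Printing Implicit Defensive.

Import GRing.Theory.
Local Open Scope ring_scope.

(* In characteristic zero the condition is void. *)
Definition perfect_field (K : fieldType) : Prop :=
  forall (p : nat) (charKp : p \in [pchar K]) (x : K),
    exists y : K, pFrobenius_aut charKp y = x.

Definition quadratically_closed (K : fieldType) : Prop :=
  forall a b c : K, a != 0 -> exists x : K, a * x ^+ 2 + b * x + c = 0.

Inductive sk_basis : Set :=
  | b1 | b2 | b3 | b4 | b5 | b6 | b7 | b8 | b9
  | c1 | c2 | c3 | c4 | c5
  | d.

Definition sk_enum : seq sk_basis :=
  [:: b1; b2; b3; b4; b5; b6; b7; b8; b9; c1; c2; c3; c4; c5; d].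

Definition sk_index (s : sk_basis) : 'I_15 :=
  match s with
  | b1 => @Ordinal 15 0 isT  | b2 => @Ordinal 15 1 isT
  | b3 => @Ordinal 15 2 isT  | b4 => @Ordinal 15 3 isT
  | b5 => @Ordinal 15 4 isT  | b6 => @Ordinal 15 5 isT
  | b7 => @Ordinal 15 6 isT  | b8 => @Ordinal 15 7 isT
  | b9 => @Ordinal 15 8 isT  | c1 => @Ordinal 15 9 isT
  | c2 => @Ordinal 15 10 isT | c3 => @Ordinal 15 11 isT
  | c4 => @Ordinal 15 12 isT | c5 => @Ordinal 15 13 isT
  | d => @Ordinal 15 14 isT
  end.

Definition sk_nth (i : 'I_15) : sk_basis := nth d sk_enum i.

Lemma sk_indexK : cancel sk_index sk_nth. Proof. by case. Qed.

Lemma sk_nthK : cancel sk_nth sk_index.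
Proof.
move=> i; apply/val_inj; case: i => i lti; rewrite /sk_nth /=.
by do 15?[case: i lti => [|i] lti //].
Qed.

(* An entry (s, t, u) means [s, t] = u. *)
Definition sk_table : seq (sk_basis * sk_basis * sk_basis) :=
  [::
    (b1, b2, b3); (b1, b3, b1); (b1, b5, b6); (b1, b6, b4); (b1, b8, b9);
    (b1, b9, b7); (b1, c1, d); (b1, c2, c3); (b1, c3, c1); (b1, c4, b2);
    (b1, c5, b5);
    (b2, b3, b2); (b2, b4, b6); (b2, b6, b5); (b2, b7, b9); (b2, b9, b8);
    (b2, c1, c3); (b2, c3, c2);
    (b3, b4, b4); (b3, b5, b5); (b3, b7, b7); (b3, b8, b8); (b3, c1, c1);
    (b3, c2, c2);
    (b4, b7, d); (b4, b8, c3); (b4, b9, c1); (b4, c1, b3); (b4, c2, c4);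
    (b4, c3, b2); (b4, c4, b5); (b4, d, b1);
    (b5, b7, c3); (b5, b9, c2); (b5, c1, c4); (b5, d, b2);
    (b6, b7, c1); (b6, b8, c2); (b6, c3, c4); (b6, d, b3);
    (b7, c1, b6); (b7, c2, c5); (b7, c3, b5); (b7, c4, b8); (b7, c5, c2);
    (b7, d, b4);
    (b8, c1, c5); (b8, d, b5); (b9, c3, c5); (b9, d, b6);
    (c1, c3, b8); (c1, c4, c2); (c1, d, b7); (c2, d, b8); (c3, d, b9);
    (c5, d, c4)].

Definition sk_lookup (s t : sk_basis) : seq sk_basis :=
  [seq p.2 | p <- sk_table
           & (sk_index s == sk_index p.1.1) && (sk_index t == sk_index p.1.2)].

Section Skryabin.

Variable K : fieldType.

Definition skryabin := 'rV[K]_15.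

Definition sk_vec (s : sk_basis) : skryabin := delta_mx 0 (sk_index s).

Definition sk_coord (x : skryabin) (s : sk_basis) : K := x 0 (sk_index s).

(* The alternating bilinear extension of the table. *)
Definition sk_bracket (x y : skryabin) : skryabin :=
  \sum_(p <- sk_table)
    let: (s, t, u) := p in
    (sk_coord x s * sk_coord y t - sk_coord x t * sk_coord y s) *: sk_vec u.

Lemma sk_bracketxx x : sk_bracket x x = 0.
Proof.
by apply: big1 => -[[s t] u] _; rewrite mulrC subrr scale0r.
Qed.

Definition sk_product (s t : sk_basis) : skryabin :=
  \sum_(u <- sk_lookup s t) sk_vec u.

Lemma sk_bracket_vec s t :
  sk_bracket (sk_vec s) (sk_vec t) = sk_product s t - sk_product t s.
Proof.
rewrite /sk_bracket /sk_product /sk_lookup; move: sk_table => r.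
rewrite !big_map !big_filter.
rewrite !(big_mkcond (fun p => _ && _)) -sumrB /=.
apply: eq_bigr => -[[s' t'] u] _.
rewrite /sk_coord /sk_vec !mxE !eqxx /= -!natrM !mulnb scalerBl.
rewrite ![sk_index s' == _]eq_sym ![sk_index t' == _]eq_sym.
rewrite [(sk_index s == sk_index t') && _]andbC.
by congr (_ - _); case: ifP; rewrite ?scale1r ?scale0r.
Qed.

Definition is_sk_aut (f : 'End(skryabin)) : Prop :=
  bijective f /\ forall x y, f (sk_bracket x y) = sk_bracket (f x) (f y).

(* Here S consists of bijective maps, so that f^-1 is the inverse of f. *)
Inductive generated (S : 'End(skryabin) -> Prop) : 'End(skryabin) -> Prop :=
  | gen_mem f of S f : generated S f
  | gen_id : generated S \1%VF
  | gen_comp f g of generated S f & generated S g : generated S (f \o g)%VF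
  | gen_inv f of generated S f : generated S (f^-1)%VF.

(* The linear map sending each basis vector s to img s. *)
Definition sk_linear (img : sk_basis -> skryabin) : 'End(skryabin) :=
  linfun (mulmxr (\matrix_(i < 15) img (sk_nth i))).

Lemma sk_linear_vec img s : sk_linear img (sk_vec s) = img s.
Proof. by rewrite lfunE /= -rowE rowK sk_indexK. Qed.

Local Notation e := sk_vec.

Definition exp_c2 (a : K) : 'End(skryabin) := sk_linear (fun s =>
  match s with
  | b1 => e b1 + a *: e c3
  | b3 => e b3 + a *: e c2
  | b4 => e b4 + a *: e c4
  | b7 => e b7 + a *: e c5
  | d => e d + a *: e b8
  | s => e s
  end).

Definition exp_c4 (a : K) : 'End(skryabin) := sk_linear (fun s =>
  match s with
  | b1 => e b1 + a *: e b2
  | b4 => e b4 + a *: e b5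
  | b7 => e b7 + a *: e b8
  | c1 => e c1 + a *: e c2
  | s => e s
  end).

Definition exp_c5 (a : K) : 'End(skryabin) := sk_linear (fun s =>
  match s with
  | b1 => e b1 + a *: e b5
  | b7 => e b7 + a *: e c2
  | d => e d + a *: e c4
  | s => e s
  end).

Definition exp_c3_sq (a : K) : 'End(skryabin) := sk_linear (fun s =>
  match s with
  | b1 => e b1 + a *: e b8
  | b4 => e b4 + a *: e c2
  | d => e d + a *: e c5
  | s => e s
  end).

Definition Phi (a : K) : 'End(skryabin) := sk_linear (fun s =>
  match s with
  | b1 => e b1 + a *: e b4
  | b2 => e b2 + a *: e b5
  | b7 => e b7 + a ^+ 2 *: e b2 + a ^+ 3 *: e b5 + a *: e c1
  | b8 => e b8 + a *: e c2
  | b9 => e b9 + a ^+ 2 *: e c4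
  | c1 => e c1 + a ^+ 2 *: e b5
  | c3 => e c3 + a *: e c4
  | d => e d + a *: e b3 + a ^+ 2 *: e b6
  | s => e s
  end).

Definition Psi (a : K) : 'End(skryabin) := sk_linear (fun s =>
  match s with
  | b1 => e b1 + a *: e b6 + a *: e c1 + a ^+ 2 *: e c4
  | b2 => e b2 + a *: e c2
  | b3 => e b3 + a *: e b5
  | b4 => e b4 + a *: e b2 + a ^+ 2 *: e c2
  | b6 => e b6 + a *: e c4
  | b7 => e b7 + a *: e b5 + a *: e c3
  | b9 => e b9 + a *: e c2 + a *: e c5
  | c1 => e c1 + a *: e b8 + a *: e c4
  | d => e d + a *: e b2 + a *: e b9 + a ^+ 2 *: e c2 + a ^+ 2 *: e c5
  | s => e s
  end).

Definition Theta (a : K) : 'End(skryabin) := sk_linear (fun s =>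
  match s with
  | b1 => e b1 + a *: e b7 + a ^+ 3 *: e b8 + a ^+ 2 *: e b9
  | b2 => e b2 + a *: e b8
  | b3 => e b3 + a ^+ 2 *: e b8
  | b4 => e b4 + a ^+ 2 *: e b5 + a *: e c1 + a ^+ 2 *: e c3 + a ^+ 3 *: e c5
  | b5 => e b5 + a *: e c2
  | b6 => e b6 + a ^+ 2 *: e c2 + a ^+ 2 *: e c5
  | c1 => e c1 + a ^+ 2 *: e c2 + a ^+ 2 *: e c5
  | c3 => e c3 + a *: e c5
  | d => e d + a ^+ 2 *: e b5 + a *: e b6 + a ^+ 3 *: e c2 + a ^+ 2 *: e c3
  | s => e s
  end).

Definition Delta (l : K) : 'End(skryabin) := sk_linear (fun s =>
  match s with
  | b1 => l ^- 2 *: e b1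
  | b2 => l ^+ 2 *: e b2
  | b3 => e b3
  | b4 => l^-1 *: e b4
  | b5 => l ^+ 3 *: e b5
  | b6 => l *: e b6
  | b7 => e b7
  | b8 => l ^+ 4 *: e b8
  | b9 => l ^+ 2 *: e b9
  | c1 => l *: e c1
  | c2 => l ^+ 5 *: e c2
  | c3 => l ^+ 3 *: e c3
  | c4 => l ^+ 4 *: e c4
  | c5 => l ^+ 5 *: e c5
  | d => l^-1 *: e d
  end).

Inductive sk_generator : 'End(skryabin) -> Prop :=
  | gen_exp_c2 a : sk_generator (exp_c2 a)
  | gen_exp_c4 a : sk_generator (exp_c4 a)
  | gen_exp_c5 a : sk_generator (exp_c5 a)
  | gen_exp_c3_sq a : sk_generator (exp_c3_sq a)
  | gen_Phi a : sk_generator (Phi a)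
  | gen_Psi a : sk_generator (Psi a)
  | gen_Theta a : sk_generator (Theta a)
  | gen_Delta l of l != 0 : sk_generator (Delta l).

Definition is_sk_aut0 : 'End(skryabin) -> Prop := generated sk_generator.

Lemma oppv_pchar2 (charK : 2%N \in [pchar K]) (x : skryabin) : - x = x.
Proof. by rewrite -scaleN1r oppr_pchar2 // scale1r. Qed.

Lemma sk_bracketx0 x : sk_bracket x 0 = 0.
Proof.
by apply: big1 => -[[s t] u] _; rewrite /sk_coord !mxE !mulr0 subrr scale0r.
Qed.

Lemma sk_bracket_vec2 (charK : 2%N \in [pchar K]) s t :
  sk_bracket (e s) (e t) = \sum_(u <- sk_lookup s t ++ sk_lookup t s) e u.
Proof. by rewrite big_cat sk_bracket_vec oppv_pchar2. Qed.

Lemma sk_bracket_some (charK : 2%N \in [pchar K]) s t u :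
  sk_lookup s t ++ sk_lookup t s = [:: u] -> sk_bracket (e s) (e t) = e u.
Proof. by rewrite sk_bracket_vec2 // => ->; rewrite big_seq1. Qed.

Lemma sk_bracket_none (charK : 2%N \in [pchar K]) s t :
  sk_lookup s t ++ sk_lookup t s = [::] -> sk_bracket (e s) (e t) = 0.
Proof. by rewrite sk_bracket_vec2 // => ->; rewrite big_nil. Qed.

Local Ltac sk_compute charK :=
  first [ erewrite (sk_bracket_none charK); [|reflexivity]
        | erewrite (sk_bracket_some charK); [|reflexivity] ].

Lemma exp_c2E (charK : 2%N \in [pchar K]) a s :
  exp_c2 a (e s) = e s + a *: sk_bracket (e c2) (e s).
Proof.
rewrite sk_linear_vec; case: s; sk_compute charK;
  solve [reflexivity | rewrite scaler0 addr0; reflexivity].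
Qed.

Lemma exp_c4E (charK : 2%N \in [pchar K]) a s :
  exp_c4 a (e s) = e s + a *: sk_bracket (e c4) (e s).
Proof.
rewrite sk_linear_vec; case: s; sk_compute charK;
  solve [reflexivity | rewrite scaler0 addr0; reflexivity].
Qed.

Lemma exp_c5E (charK : 2%N \in [pchar K]) a s :
  exp_c5 a (e s) = e s + a *: sk_bracket (e c5) (e s).
Proof.
rewrite sk_linear_vec; case: s; sk_compute charK;
  solve [reflexivity | rewrite scaler0 addr0; reflexivity].
Qed.

Lemma exp_c3_sqE (charK : 2%N \in [pchar K]) a s :
  exp_c3_sq a (e s) =
  e s + a *: sk_bracket (e c3) (sk_bracket (e c3) (e s)).
Proof.
rewrite sk_linear_vec; case: s;
  sk_compute charK; first [rewrite sk_bracketx0 | sk_compute charK];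
  solve [reflexivity | rewrite scaler0 addr0; reflexivity].
Qed.

End Skryabin.

(* Main.v *)
From Stdlib Require Import Ring_theory Ring_polynom ListTactics.
Require Import Defs.
From mathcomp Require Import all_boot all_order all_algebra.
From mathcomp Require Import ring.

Set Implicit Arguments.
Unset Strict Implicit.
Unset Printing Implicit Defensive.

Import GRing.Theory.
Local Open Scope ring_scope.

(** The algebra L is generated by b1, c2, c4 and c5, so an automorphism f is
    known once its values on these four elements are. The last three are
    rigid: each spans a line that every automorphism preserves, because the
    line can be described by means of the bracket alone.

    In characteristic 2 the map x |-> (ad x)^2 is additive modulo inner
    derivations and 2-semilinear, so S = {x | (ad x)^2 is inner} is a
    subspace; it is cut out by x_b1 = x_b7 = x_c3 = 0 and x_b4 = x_d
    ([inner_squareP]). Put Z = {x | [x, S] <= S}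
    = <b5, b6, b9, c2, c3, c4, c5> ([square_normalizerP]). Then
    <c5> = {x | [x, L] <= Z} ([c5_lineP]), <c2> = [Z :&: S, Z :&: S]
    ([aut_c2]) and <c4> = [S, <c5>] ([aut_c4]). Consequently f scales c5, c2
    and c4 by nonzero v, u and w.

    It remains to control y = f(b1). Its b1-coordinate is nonzero: otherwise
    f(b5) = [y, v c5] would lie in f(<c2, c4>) ([aut_b1_pivot]). Each of the
    eight families of generators moves b1 in its own direction: Delta rescales
    it, and Phi, Theta, Psi, exp(c4), exp(c5), exp(c2), exp(c3^[2]) add
    multiples of b4, b7, b6, b2, b5, c3, b8 respectively. Applied in this
    order they bring y to the form
    b1 + (a combination of b3, b9, c1, c2, c4, c5, d) ([normalize]).

    For such a y nothing is left to choose. The elements f(b2) = [y, w c4] and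
    f(b3) = [y, f(b2)] are explicit, and the relation [b1, b3] = b1 forces
    w = 1 and removes b3, c4 and d from y. Then f(c3), f(c1), f(d) are
    explicit, and [b1, d] = 0 removes everything else, so y = b1
    ([normalized_aut_id]). Now f is diagonal; comparing the scalars
    along [b4, d] = b1 and [b7, d] = b4 gives u v = 1 and u^3 = v, so
    u^4 = 1 and u = v = 1 because the characteristic is 2 ([aut_fixed_b1]).
    Thus f followed by a product of generators is the identity.

    That the generators are automorphisms is a matter of polynomial identities
    over F_2 in the coordinates of two arbitrary vectors and the parameter
    ([sk_generator_aut]). *)

Section SkryabinAutomorphisms.

Variables (K : fieldType) (charK : 2%N \in [pchar K]).

(** * Polynomial identities in characteristic 2 *)

Let subK (x y : K) := x - y.
Let F2_val (a : bool) : K := if a then 1 else 0.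

Lemma field_ring_theory : ring_theory 0 1 +%R *%R subK -%R eq.
Proof.
split=> //; [exact: add0r | exact: addrC | exact: addrA | exact: mul1r
  | exact: mulrC | exact: mulrA | exact: mulrDl | exact: subrr].
Qed.

Lemma field_ring_eq_ext : ring_eq_ext +%R *%R (-%R : K -> K) eq.
Proof. by split; [move=> ? ? -> ? ? ->.. | move=> ? ? ->]. Qed.

Lemma F2_val_morph :
  ring_morph 0 1 +%R *%R subK -%R eq false true addb andb addb id eqb F2_val.
Proof.
have two0 : 1 + 1 = 0 :> K by rewrite addrr_pchar2.
have opp1 : -1 = 1 :> K by rewrite oppr_pchar2.
rewrite /subK; split=> //.
- by case=> -[]; rewrite /= ?two0 ?addr0 ?add0r.
- by case=> -[]; rewrite /= ?subrr ?subr0 // sub0r opp1.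
- by case=> -[]; rewrite /= ?mulr0 ?mulr1.
- by case; rewrite /= ?oppr0 ?opp1.
- by move=> x y /eqP->.
Qed.

Definition F2_div (a b : bool) := if b then (a, false) else (false, a).

Lemma F2_divP : div_theory eq addb andb F2_val F2_div.
Proof. by split; case=> -[]. Qed.

(** Normalising polynomials with booleans as coefficients makes x + x vanish,
    which normalisation with integer coefficients cannot do. *)
Definition pchar2_ring_correct :=
  ring_correct (@Eqsth K) field_ring_eq_ext
    (Rth_ARth (@Eqsth K) field_ring_eq_ext field_ring_theory)
    F2_val_morph (pow_N_th 1 *%R (@Eqsth K)) F2_divP.

Ltac reify_vars t vs :=
  lazymatch t with
  | @GRing.add _ ?a ?b => let vs := reify_vars a vs in reify_vars b vs
  | @GRing.mul _ ?a ?b => let vs := reify_vars a vs in reify_vars b vs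
  | @GRing.opp _ ?a => reify_vars a vs
  | @GRing.exp _ ?a _ => reify_vars a vs
  | @GRing.zero _ => vs
  | @GRing.one _ => vs
  | _ => AddFvTail t vs
  end.

(* Powers are unfolded with the association used by x ^+ n, so that the
   reified term evaluates to the original one by conversion. *)
Ltac reify_pow p n :=
  lazymatch n with
  | 0%N => constr:(@PEc bool true)
  | 1%N => p
  | S ?m => let q := reify_pow p m in constr:(PEmul p q)
  end.

Ltac reify t vs :=
  lazymatch t with
  | @GRing.add _ ?a ?b =>
      let p := reify a vs in let q := reify b vs in constr:(PEadd p q)
  | @GRing.mul _ ?a ?b =>
      let p := reify a vs in let q := reify b vs in constr:(PEmul p q)
  | @GRing.opp _ ?a => let p := reify a vs in constr:(PEopp p)
  | @GRing.exp _ ?a ?n =>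
      let p := reify a vs in let n := eval compute in n in reify_pow p n
  | @GRing.zero _ => constr:(@PEc bool false)
  | @GRing.one _ => constr:(@PEc bool true)
  | _ => let i := Find_at t vs in constr:(@PEX bool i)
  end.

Ltac ring2 :=
  lazymatch goal with
  | |- @eq _ ?a ?b =>
      let T := type of a in
      let vs := reify_vars a (@nil T) in let vs := reify_vars b vs in
      let p := reify a vs in let q := reify b vs in
      apply (@pchar2_ring_correct 5 vs nil p q I); vm_compute; reflexivity
  end.

(** The form in which a known equation r = s is used: the difference between
    it and the equation sought is a polynomial identity. *)
Lemma pchar2_transfer (r s p q : K) : r = s -> p + q = r + s -> p = q.
Proof.
move=> ->; rewrite (addrr_pchar2 charK) => /eqP.
by rewrite addr_eq0 oppr_pchar2 // => /eqP.
Qed.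

(** * Vectors as coordinate functions *)

Local Notation e := (@sk_vec K).
Implicit Types (x y z : skryabin K) (F G : sk_basis -> K).
Implicit Types (f g : 'End(skryabin K)) (s t : sk_basis).

(** Once every vector is written as [sk_of] of an explicit function, an equation
    between vectors becomes 15 polynomial identities by mere reduction. *)
Definition sk_of F : skryabin K := \row_i F (sk_nth i).

Lemma sk_coord_of F s : sk_coord (sk_of F) s = F s.
Proof. by rewrite /sk_coord mxE sk_indexK. Qed.

Lemma sk_of_coord x : sk_of (sk_coord x) = x.
Proof. by apply/rowP=> i; rewrite mxE /sk_coord sk_nthK. Qed.

Lemma eq_sk_of F G : F =1 G -> sk_of F = sk_of G.
Proof. by move=> eqFG; apply/rowP=> i; rewrite !mxE. Qed.

Lemma sk_of_inj F G : sk_of F = sk_of G -> F =1 G.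
Proof. by move=> eqFG s; rewrite -sk_coord_of eqFG sk_coord_of. Qed.

Lemma sk_of_add F G : sk_of F + sk_of G = sk_of (fun s => F s + G s).
Proof. by apply/rowP=> i; rewrite !mxE. Qed.

Lemma sk_of_scale a F : a *: sk_of F = sk_of (fun s => a * F s).
Proof. by apply/rowP=> i; rewrite !mxE. Qed.

Lemma sk_of_0 : 0 = sk_of (fun=> 0).
Proof. by apply/rowP=> i; rewrite !mxE. Qed.

Lemma sk_of_vec s :
  e s = sk_of (fun t => if sk_index t == sk_index s :> nat then 1 else 0).
Proof.
apply/rowP=> i; rewrite !mxE sk_nthK eqxx /=.
by case: eqP => [->|neq]; [rewrite eqxx | case: eqP => // /val_inj].
Qed.

Definition sk_ofE := (sk_of_vec, sk_of_0, sk_of_scale, sk_of_add).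

Lemma sk_of_expand F : sk_of F = \sum_(s <- sk_enum) F s *: e s.
Proof.
by rewrite unlock /= !sk_ofE; apply: eq_sk_of => -[] /=; ring2.
Qed.

Lemma linear_sk_of f F : f (sk_of F) = \sum_(s <- sk_enum) F s *: f (e s).
Proof.
by rewrite sk_of_expand linear_sum; apply: eq_bigr => s _; rewrite linearZ.
Qed.

Lemma lfun_basis_eq f g : (forall s, f (e s) = g (e s)) -> f = g.
Proof.
move=> fg; apply/lfunP => x; rewrite -[x]sk_of_coord !linear_sk_of.
by apply: eq_bigr => s _; congr (_ *: _); apply: fg.
Qed.

Lemma sk_bracket_of F G :
  let m t u := F t * G u + F u * G t in
  sk_bracket (sk_of F) (sk_of G) = sk_of (fun s => match s with
  | b1 => m b1 b3 + m b4 d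
  | b2 => m b2 b3 + m b1 c4 + m b4 c3 + m b5 d
  | b3 => m b1 b2 + m b4 c1 + m b6 d
  | b4 => m b1 b6 + m b3 b4 + m b7 d
  | b5 => m b1 c5 + m b2 b6 + m b3 b5 + m b4 c4 + m b7 c3 + m b8 d
  | b6 => m b1 b5 + m b2 b4 + m b7 c1 + m b9 d
  | b7 => m b1 b9 + m b3 b7 + m c1 d
  | b8 => m b2 b9 + m b3 b8 + m b7 c4 + m c1 c3 + m c2 d
  | b9 => m b1 b8 + m b2 b7 + m c3 d
  | c1 => m b1 c3 + m b3 c1 + m b4 b9 + m b6 b7
  | c2 => m b2 c3 + m b3 c2 + m b5 b9 + m b6 b8 + m b7 c5 + m c1 c4
  | c3 => m b1 c2 + m b2 c1 + m b4 b8 + m b5 b7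
  | c4 => m b4 c2 + m b5 c1 + m b6 c3 + m c5 d
  | c5 => m b7 c2 + m b8 c1 + m b9 c3
  | d => m b1 c1 + m b4 b7
  end).
Proof.
move=> m; rewrite /sk_bracket unlock /=.
rewrite !sk_coord_of !sk_ofE; apply: eq_sk_of => s.
by rewrite {}/m; case: s => /=; ring2.
Qed.

Ltac sk_eq := apply: eq_sk_of => -[] /=; ring2.
Ltac sk_calc := rewrite !(sk_ofE, sk_bracket_of); sk_eq.

(* [read E t] proves an equation that is, up to a polynomial identity, the
   t-coordinate of the equality of functions E. *)
Ltac read E t := apply: (pchar2_transfer (E t)); rewrite /=; ring2.

(** * The generators are automorphisms *)

Definition preserves_bracket f :=
  forall x y, f (sk_bracket x y) = sk_bracket (f x) (f y).

Lemma preserves_bracketP f :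
  (forall F G, f (sk_bracket (sk_of F) (sk_of G)) =
     sk_bracket (f (sk_of F)) (f (sk_of G))) -> preserves_bracket f.
Proof. by move=> fB x y; rewrite -(sk_of_coord x) -(sk_of_coord y). Qed.

Ltac sk_linear_calc f :=
  rewrite linear_sk_of unlock /=; rewrite /f !sk_linear_vec; sk_calc.

Lemma exp_c2_of (a : K) F :
  exp_c2 a (sk_of F) = sk_of (fun s => match s with
  | b8 => F b8 + a * F d
  | c2 => F c2 + a * F b3
  | c3 => F c3 + a * F b1
  | c4 => F c4 + a * F b4
  | c5 => F c5 + a * F b7
  | s => F s end).
Proof. sk_linear_calc exp_c2. Qed.

Lemma exp_c4_of (a : K) F :
  exp_c4 a (sk_of F) = sk_of (fun s => match s with
  | b2 => F b2 + a * F b1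
  | b5 => F b5 + a * F b4
  | b8 => F b8 + a * F b7
  | c2 => F c2 + a * F c1
  | s => F s end).
Proof. sk_linear_calc exp_c4. Qed.

Lemma exp_c5_of (a : K) F :
  exp_c5 a (sk_of F) = sk_of (fun s => match s with
  | b5 => F b5 + a * F b1
  | c2 => F c2 + a * F b7
  | c4 => F c4 + a * F d
  | s => F s end).
Proof. sk_linear_calc exp_c5. Qed.

Lemma exp_c3_sq_of (a : K) F :
  exp_c3_sq a (sk_of F) = sk_of (fun s => match s with
  | b8 => F b8 + a * F b1
  | c2 => F c2 + a * F b4
  | c5 => F c5 + a * F d
  | s => F s end).
Proof. sk_linear_calc exp_c3_sq. Qed.

Lemma Phi_of (a : K) F :
  Phi a (sk_of F) = sk_of (fun s => match s with
  | b2 => F b2 + a ^+ 2 * F b7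
  | b3 => F b3 + a * F d
  | b4 => F b4 + a * F b1
  | b5 => F b5 + a * F b2 + a ^+ 3 * F b7 + a ^+ 2 * F c1
  | b6 => F b6 + a ^+ 2 * F d
  | c1 => F c1 + a * F b7
  | c2 => F c2 + a * F b8
  | c4 => F c4 + a ^+ 2 * F b9 + a * F c3
  | s => F s end).
Proof. sk_linear_calc Phi. Qed.

Lemma Psi_of (a : K) F :
  Psi a (sk_of F) = sk_of (fun s => match s with
  | b2 => F b2 + a * F b4 + a * F d
  | b5 => F b5 + a * F b3 + a * F b7
  | b6 => F b6 + a * F b1
  | b8 => F b8 + a * F c1
  | b9 => F b9 + a * F d
  | c1 => F c1 + a * F b1
  | c2 => F c2 + a * F b2 + a ^+ 2 * F b4 + a * F b9 + a ^+ 2 * F d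
  | c3 => F c3 + a * F b7
  | c4 => F c4 + a ^+ 2 * F b1 + a * F b6 + a * F c1
  | c5 => F c5 + a * F b9 + a ^+ 2 * F d
  | s => F s end).
Proof. sk_linear_calc Psi. Qed.

Lemma Theta_of (a : K) F :
  Theta a (sk_of F) = sk_of (fun s => match s with
  | b5 => F b5 + a ^+ 2 * F b4 + a ^+ 2 * F d
  | b6 => F b6 + a * F d
  | b7 => F b7 + a * F b1
  | b8 => F b8 + a ^+ 3 * F b1 + a * F b2 + a ^+ 2 * F b3
  | b9 => F b9 + a ^+ 2 * F b1
  | c1 => F c1 + a * F b4
  | c2 => F c2 + a * F b5 + a ^+ 2 * F b6 + a ^+ 2 * F c1 + a ^+ 3 * F d
  | c3 => F c3 + a ^+ 2 * F b4 + a ^+ 2 * F d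
  | c5 => F c5 + a ^+ 3 * F b4 + a ^+ 2 * F b6 + a ^+ 2 * F c1 + a * F c3
  | s => F s end).
Proof. sk_linear_calc Theta. Qed.

Lemma Delta_of (l : K) F :
  Delta l (sk_of F) = sk_of (fun s => match s with
  | b1 => l ^- 2 * F b1
  | b2 => l ^+ 2 * F b2
  | b4 => l^-1 * F b4
  | b5 => l ^+ 3 * F b5
  | b6 => l * F b6
  | b8 => l ^+ 4 * F b8
  | b9 => l ^+ 2 * F b9
  | c1 => l * F c1
  | c2 => l ^+ 5 * F c2
  | c3 => l ^+ 3 * F c3
  | c4 => l ^+ 4 * F c4
  | c5 => l ^+ 5 * F c5
  | d => l^-1 * F d
  | s => F s end).
Proof. sk_linear_calc Delta. Qed.

Ltac sk_preserves gen_of :=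
  apply: preserves_bracketP => ? ?; rewrite !(sk_bracket_of, gen_of); sk_eq.

Lemma exp_c2_bracket a : preserves_bracket (exp_c2 a).
Proof. sk_preserves exp_c2_of. Qed.

Lemma exp_c4_bracket a : preserves_bracket (exp_c4 a).
Proof. sk_preserves exp_c4_of. Qed.

Lemma exp_c5_bracket a : preserves_bracket (exp_c5 a).
Proof. sk_preserves exp_c5_of. Qed.

Lemma exp_c3_sq_bracket a : preserves_bracket (exp_c3_sq a).
Proof. sk_preserves exp_c3_sq_of. Qed.

Lemma Phi_bracket a : preserves_bracket (Phi a).
Proof. sk_preserves Phi_of. Qed.

Lemma Psi_bracket a : preserves_bracket (Psi a).
Proof. sk_preserves Psi_of. Qed.

Lemma Theta_bracket a : preserves_bracket (Theta a).
Proof. sk_preserves Theta_of. Qed.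

(** Delta is the torus of a grading of L, the exponents of l being degrees. *)
Lemma Delta_bracket (l : K) : l != 0 -> preserves_bracket (Delta l).
Proof.
move=> l0; apply: preserves_bracketP => F G.
by rewrite !(sk_bracket_of, Delta_of); apply: eq_sk_of => -[]; field.
Qed.

Lemma sk_aut_of_cancel f g :
  preserves_bracket f -> (forall F, g (f (sk_of F)) = sk_of F) ->
  (forall F, f (g (sk_of F)) = sk_of F) -> is_sk_aut f.
Proof.
move=> fB gf fg; split=> //; exists g => x; rewrite -[x]sk_of_coord.
  exact: gf.
exact: fg.
Qed.

(** All unipotent generators are involutions except Psi, for which
    Psi(a)^2 = exp(a^2 c3^[2]). *)
Lemma sk_generator_aut f : sk_generator f -> is_sk_aut f.
Proof.
have inv g : preserves_bracket g -> (forall F, g (g (sk_of F)) = sk_of F) ->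
    is_sk_aut g by move=> gB gg; exact: (sk_aut_of_cancel gB gg gg).
case=> [a|a|a|a|a|a|a|l l0].
- by apply: inv (exp_c2_bracket a) _ => F; rewrite !exp_c2_of; sk_eq.
- by apply: inv (exp_c4_bracket a) _ => F; rewrite !exp_c4_of; sk_eq.
- by apply: inv (exp_c5_bracket a) _ => F; rewrite !exp_c5_of; sk_eq.
- by apply: inv (exp_c3_sq_bracket a) _ => F; rewrite !exp_c3_sq_of; sk_eq.
- by apply: inv (Phi_bracket a) _ => F; rewrite !Phi_of; sk_eq.
- pose g := (Psi a \o exp_c3_sq (a ^+ 2))%VF.
  by apply: (sk_aut_of_cancel (Psi_bracket a) (g := g)) => F;
    rewrite comp_lfunE /= !(Psi_of, exp_c3_sq_of); sk_eq.
- by apply: inv (Theta_bracket a) _ => F; rewrite !Theta_of; sk_eq.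
- apply: (sk_aut_of_cancel (Delta_bracket l0) (g := Delta l^-1)) => F;
    by rewrite !Delta_of; apply: eq_sk_of => -[] /=;
      rewrite ?exprVn ?invrK ?(mulKf, mulVKf) ?expf_neq0.
Qed.

Lemma sk_aut_comp f g : is_sk_aut f -> is_sk_aut g -> is_sk_aut (f \o g)%VF.
Proof.
move=> [bij_f fB] [bij_g gB]; split=> [|x y]; last first.
  by rewrite !comp_lfunE /= gB fB.
by apply: (eq_bij (bij_comp bij_f bij_g)) => x; rewrite comp_lfunE.
Qed.

Lemma sk_autK f : is_sk_aut f -> cancel f (f^-1)%VF /\ cancel (f^-1)%VF f.
Proof.
move=> [/bij_inj f_inj _]; have f0 : lker f == 0%VS by apply/lker0P.
by split; [apply: lker0_lfunK | apply: lker0_lfunVK].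
Qed.

Lemma sk_aut_inv f : is_sk_aut f -> is_sk_aut (f^-1)%VF.
Proof.
move=> aut_f; have [fK Kf] := sk_autK aut_f; have [_ fB] := aut_f.
split=> [|x y]; first by exists f.
by rewrite -{1}(Kf x) -{1}(Kf y) -fB fK.
Qed.

Lemma sk_aut0_aut f : is_sk_aut0 f -> is_sk_aut f.
Proof.
elim=> {f} [f /sk_generator_aut //| |f g _ + _|f _].
- by split=> [|x y]; [exists id => x | ]; rewrite !id_lfunE.
- exact: sk_aut_comp.
- exact: sk_aut_inv.
Qed.

(** * Lines preserved by every automorphism *)

Definition inner_square x :=
  exists z, forall y, sk_bracket x (sk_bracket x y) = sk_bracket z y.

Definition square_normalizer x :=
  forall y, inner_square y -> inner_square (sk_bracket x y).

(** At the four matrix entries read off below every inner derivation vanishes,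
    while (ad x)^2 has there the square of a linear form in x. *)
Lemma inner_squareP F :
  inner_square (sk_of F) <->
  [/\ F b1 = 0, F b7 = 0, F c3 = 0 & F b4 = F d].
Proof.
split=> [[z zP] | [F1 F7 Fc3 F4]].
  have sq0 (a : K) : a ^+ 2 = 0 -> a = 0 by move/eqP; rewrite expf_eq0 => /eqP.
  move: zP; rewrite -[z]sk_of_coord; move: (sk_coord z) => {z} G zP.
  split; [apply: sq0 | apply: sq0 | apply: sq0 |].
  - by have := zP (e b2); rewrite !(sk_ofE, sk_bracket_of) => /sk_of_inj E; read E b1.
  - by have := zP (e b6); rewrite !(sk_ofE, sk_bracket_of) => /sk_of_inj E; read E b6.
  - by have := zP (e b1); rewrite !(sk_ofE, sk_bracket_of) => /sk_of_inj E; read E b8.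
  have F4d : (F b4 + F d) ^+ 2 = 0.
    by have := zP (e b7); rewrite !(sk_ofE, sk_bracket_of) => /sk_of_inj E; read E b1.
  by apply: (pchar2_transfer (sq0 _ F4d)); ring2.
(* The witness solves the linear system obtained by letting y run through the
   basis. *)
exists (sk_of (fun s => match s with
  | b1 => F d ^+ 2
  | b2 => F b2 * F b3 + F b5 * F d
  | b3 => F b3 ^+ 2 + F b6 * F d + F c1 * F d
  | b4 => F b3 * F d
  | b5 => F b2 * F b6 + F b3 * F b5 + F b8 * F d + F c4 * F d
  | b6 => F b2 * F d + F b9 * F d
  | b7 => F c1 * F d
  | b8 => F b2 * F b9 + F b3 * F b8 + F c2 * F d
  | b9 => F c1 ^+ 2
  | c1 => F b3 * F c1 + F b9 * F d
  | c2 => F b3 * F c2 + F b5 * F b9 + F b6 * F b8 + F c1 * F c4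
  | c3 => F b2 * F c1 + F b8 * F d
  | c4 => F b2 ^+ 2 + F b5 * F c1 + F c2 * F d + F c5 * F d
  | c5 => F b8 * F c1
  | d => 0 end)) => y.
rewrite -[y]sk_of_coord !sk_bracket_of.
by apply: eq_sk_of => -[] /=; rewrite ?(F1, F7, Fc3, F4); ring2.
Qed.

(** Bracketing with b3, c1 and b4 + d already detects all eight coordinates. *)
Lemma square_normalizerP F :
  square_normalizer (sk_of F) <->
  [/\ [/\ F b1 = 0, F b2 = 0, F b3 = 0 & F b4 = 0]
    & [/\ F b7 = 0, F b8 = 0, F c1 = 0 & F d = 0]].
Proof.
split=> [nF | [[F1 F2 F3 F4] [F7 F8 Fc1 Fd]] s].
  have S3 : inner_square (e b3) by rewrite sk_of_vec; apply/inner_squareP.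
  have Sc1 : inner_square (e c1) by rewrite sk_of_vec; apply/inner_squareP.
  have S4d : inner_square (e b4 + e d).
    by rewrite !sk_ofE; apply/inner_squareP; split; rewrite //= ?add0r ?addr0.
  have [] := (nF _ S3, nF _ Sc1, nF _ S4d).
  rewrite !(sk_ofE, sk_bracket_of) => -[].
  move=> /inner_squareP /= [E1 E7 _ E4].
  move=> /inner_squareP /= [_ Ed E2 _].
  move=> /inner_squareP /= [_ Ec1 E8 E3].
  by split; split;
    [ apply: (pchar2_transfer E1) | apply: (pchar2_transfer E2)
    | apply: (pchar2_transfer E3) | apply: (pchar2_transfer E4)
    | apply: (pchar2_transfer E7) | apply: (pchar2_transfer E8)
    | apply: (pchar2_transfer Ec1) | apply: (pchar2_transfer Ed)]; ring2.
rewrite -[s]sk_of_coord; move: (sk_coord s) => G /inner_squareP[G1 G7 Gc3 G4].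
rewrite sk_bracket_of; apply/inner_squareP.
by split; rewrite ?(F1, F2, F3, F4, F7, F8, Fc1, Fd) ?(G1, G7, Gc3, G4); ring2.
Qed.

Lemma c5_lineP F :
  (forall y, square_normalizer (sk_bracket (sk_of F) y)) <->
  sk_of F = F c5 *: e c5.
Proof.
split=> [nF | -> y]; last first.
  rewrite -[y]sk_of_coord !(sk_ofE, sk_bracket_of).
  by apply/square_normalizerP; split; split => /=; ring2.
have [[]] := (nF (e b1), nF (e b3), nF (e b4), nF (e d)).
rewrite !(sk_ofE, sk_bracket_of) => -[].
move=> /square_normalizerP /= [[E3 Ec4 E2 E6] [E9 _ Ec3 Ec1]].
move=> /square_normalizerP /= [[E1 _ _ E4] [E7 E8 _ _]].
move=> /square_normalizerP /= [[Ed _ _ _] _].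
move=> /square_normalizerP /= [[_ E5 _ _] [_ Ec2 _ _]].
apply: eq_sk_of => -[] /=;
  [ apply: (pchar2_transfer E1) | apply: (pchar2_transfer E2)
  | apply: (pchar2_transfer E3) | apply: (pchar2_transfer E4)
  | apply: (pchar2_transfer E5) | apply: (pchar2_transfer E6)
  | apply: (pchar2_transfer E7) | apply: (pchar2_transfer E8)
  | apply: (pchar2_transfer E9) | apply: (pchar2_transfer Ec1)
  | apply: (pchar2_transfer Ec2) | apply: (pchar2_transfer Ec3)
  | apply: (pchar2_transfer Ec4) | | apply: (pchar2_transfer Ed)]; ring2.
Qed.

Lemma aut_inner_square f x :
  is_sk_aut f -> inner_square x -> inner_square (f x).
Proof.
move=> aut_f [z zP]; have [_ Kf] := sk_autK aut_f; have [_ fB] := aut_f.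
by exists (f z) => y; rewrite -(Kf y) -!fB zP.
Qed.

Lemma aut_square_normalizer f x :
  is_sk_aut f -> square_normalizer x -> square_normalizer (f x).
Proof.
move=> aut_f nx s Ss; have [_ Kf] := sk_autK aut_f; have [_ fB] := aut_f.
rewrite -(Kf s) -fB; apply: (aut_inner_square aut_f); apply: nx.
exact: aut_inner_square (sk_aut_inv aut_f) Ss.
Qed.

Lemma aut_vec_neq0 f s a x : is_sk_aut f -> f (e s) = a *: x -> a != 0.
Proof.
move=> [/bij_inj f_inj _] fs; apply/eqP => a0; move: fs.
rewrite a0 scale0r -(linear0 f) => /f_inj.
by rewrite !sk_ofE => /sk_of_inj/(_ s)/eqP; rewrite /= eqxx oner_eq0.
Qed.

Lemma aut_c5 f : is_sk_aut f -> exists2 v, v != 0 & f (e c5) = v *: e c5.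
Proof.
move=> aut_f; have [_ Kf] := sk_autK aut_f; have [_ fB] := aut_f.
have fc5 : f (e c5) = sk_coord (f (e c5)) c5 *: e c5.
  rewrite -{1}[f (e c5)]sk_of_coord; apply/c5_lineP => y.
  rewrite sk_of_coord -(Kf y) -fB; apply: (aut_square_normalizer aut_f).
  by move: {y} (_ y); rewrite sk_of_vec; apply/c5_lineP; sk_calc.
by eexists; [apply: aut_vec_neq0 aut_f fc5 | apply: fc5].
Qed.

(** b5 and b9 lie in the intersection of the two preserved subspaces, whose
    derived algebra is the line of [b5, b9] = c2. *)
Lemma aut_c2 f : is_sk_aut f -> exists2 u, u != 0 & f (e c2) = u *: e c2.
Proof.
move=> aut_f; have [_ fB] := aut_f.
suff [u fc2] : exists u, f (e c2) = u *: e c2.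
  by eexists; [apply: aut_vec_neq0 aut_f fc2 | apply: fc2].
have N s : s = b5 \/ s = b9 ->
    inner_square (f (e s)) /\ square_normalizer (f (e s)).
  move=> bs; split; [apply: (aut_inner_square aut_f)
                   | apply: (aut_square_normalizer aut_f)]; rewrite sk_of_vec.
    by apply/inner_squareP; case: bs => ->.
  by apply/square_normalizerP; case: bs => ->.
have <- : sk_bracket (e b5) (e b9) = e c2 by sk_calc.
rewrite fB; move: (N b5 (or_introl erefl)) (N b9 (or_intror erefl)).
rewrite -[f (e b5)]sk_of_coord -[f (e b9)]sk_of_coord.
move: (sk_coord _) (sk_coord _) => F G.
move=> [/inner_squareP[_ _ Fc3 _]].
move=> /square_normalizerP[[F1 F2 F3 F4] [F7 F8 Fc1 Fd]].
move=> [/inner_squareP[_ _ Gc3 _]].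
move=> /square_normalizerP[[G1 G2 G3 G4] [G7 G8 Gc1 Gd]].
exists (F b5 * G b9 + F b9 * G b5).
rewrite !(sk_ofE, sk_bracket_of); apply: eq_sk_of => -[] /=;
by rewrite ?(F1, F2, F3, F4, F7, F8, Fc1, Fc3, Fd)
           ?(G1, G2, G3, G4, G7, G8, Gc1, Gc3, Gd); ring2.
Qed.

(** [b4 + d, c5] = c4, and the bracket of c5 with any element of the preserved
    subspace containing b4 + d is a multiple of c4. *)
Lemma aut_c4 f : is_sk_aut f -> exists2 w, w != 0 & f (e c4) = w *: e c4.
Proof.
move=> aut_f; have [_ fB] := aut_f; have [v _ fc5] := aut_c5 aut_f.
suff [w fc4] : exists w, f (e c4) = w *: e c4.
  by eexists; [apply: aut_vec_neq0 aut_f fc4 | apply: fc4].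
have : inner_square (f (e b4 + e d)).
  apply: (aut_inner_square aut_f); rewrite !sk_ofE; apply/inner_squareP.
  by split; rewrite //= ?add0r ?addr0.
have <- : sk_bracket (e b4 + e d) (e c5) = e c4 by sk_calc.
rewrite fB fc5 -[f (e b4 + e d)]sk_of_coord.
move: (sk_coord _) => F /inner_squareP[F1 F7 _ _].
exists (F d * v); rewrite !(sk_ofE, sk_bracket_of).
by apply: eq_sk_of => -[] /=; rewrite ?(F1, F7); ring2.
Qed.

(** * Automorphisms in normal form *)

(** [b1, c5] = b5, while the remaining coordinates of f(b1) contribute to
    [f(b1), c5] only multiples of c2 and c4, that is, images of multiples of
    c2 and c4. *)
Lemma aut_b1_pivot f : is_sk_aut f -> sk_coord (f (e b1)) b1 != 0.
Proof.
move=> aut_f; have [/bij_inj f_inj fB] := aut_f.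
have [v _ fc5] := aut_c5 aut_f.
have [u u0 fc2] := aut_c2 aut_f; have [w w0 fc4] := aut_c4 aut_f.
apply/eqP; set y := f (e b1) => y1.
have E : sk_bracket (e b1) (e c5) = e b5 by sk_calc.
pose p := v * sk_coord y b7 / u; pose q := v * sk_coord y d / w.
have : f (e b5) = f (p *: e c2 + q *: e c4).
  rewrite linearD !linearZ /= fc2 fc4 !scalerA !divfK // -E fB -/y fc5.
  rewrite -[y]sk_of_coord; move: (sk_coord y) y1 => F F1.
  rewrite !(sk_ofE, sk_bracket_of).
  by apply: eq_sk_of => -[] /=; rewrite ?sk_coord_of ?F1; ring2.
move/f_inj; rewrite !sk_ofE => /sk_of_inj/(_ b5)/eqP /=.
by rewrite !mulr0 addr0 oner_eq0.
Qed.

(** As b1, c2, c4 and c5 generate L by brackets of basis elements, f is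
    diagonal; the structure constants then determine its eigenvalues. *)
Lemma aut_fixed_b1 f :
  is_sk_aut f -> f (e b1) = e b1 -> f (e c4) = e c4 -> f = \1%VF.
Proof.
move=> aut_f fb1 fc4; have [_ fB] := aut_f.
have [v v0 fc5] := aut_c5 aut_f; have [u u0 fc2] := aut_c2 aut_f.
have step r s t a b : sk_bracket (e r) (e s) = e t -> f (e r) = a *: e r ->
    f (e s) = b *: e s -> f (e t) = (a * b) *: e t.
  move=> E fr fs; rewrite -E fB fr fs -[e r]sk_of_coord -[e s]sk_of_coord.
  by sk_calc.
have b1step s t a : sk_bracket (e b1) (e s) = e t ->
    f (e s) = a *: e s -> f (e t) = a *: e t.
  by move=> E fs; rewrite -[a]mul1r; apply: step E _ fs; rewrite scale1r.
have fc3 : f (e c3) = u *: e c3 by apply: b1step fc2; sk_calc.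
have fc1 : f (e c1) = u *: e c1 by apply: b1step fc3; sk_calc.
have fd : f (e d) = u *: e d by apply: b1step fc1; sk_calc.
have fb5 : f (e b5) = v *: e b5 by apply: b1step fc5; sk_calc.
have fb6 : f (e b6) = v *: e b6 by apply: b1step fb5; sk_calc.
have fb4 : f (e b4) = v *: e b4 by apply: b1step fb6; sk_calc.
have fb2 : f (e b2) = 1 *: e b2.
  by apply: (b1step c4); [sk_calc | rewrite scale1r].
have fb3 : f (e b3) = 1 *: e b3 by apply: b1step fb2; sk_calc.
have fb8 : f (e b8) = (u * u) *: e b8 by apply: step fc2 fd; sk_calc.
have fb9 : f (e b9) = (u * u) *: e b9 by apply: b1step fb8; sk_calc.
have fb7 : f (e b7) = (u * u) *: e b7 by apply: b1step fb9; sk_calc.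
have vu : v * u = 1.
  have : f (e b1) = (v * u) *: e b1 by apply: step fb4 fd; sk_calc.
  by rewrite fb1 !sk_ofE => /sk_of_inj E; read E b1.
have uv : u * u * u = v.
  have : f (e b4) = (u * u * u) *: e b4 by apply: step fb7 fd; sk_calc.
  by rewrite fb4 !sk_ofE => /sk_of_inj E; read E b4.
have u1 : u = 1.
  have : (u + 1) ^+ 4 = 0 by apply: (pchar2_transfer vu); rewrite -uv; ring2.
  by move/eqP; rewrite expf_eq0 /= addr_eq0 oppr_pchar2 // => /eqP.
have v1 : v = 1 by rewrite -uv u1 !mul1r.
move: fc2 fc3 fc1 fd fb5 fb6 fb4 fb2 fb3 fb8 fb9 fb7 fc5.
rewrite u1 v1 mul1r !scale1r => *.
by apply: lfun_basis_eq => -[]; rewrite id_lfunE.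
Qed.

(** The coordinates that vanish are those in the directions in which the
    unipotent generators move b1. *)
Definition normalized x :=
  [/\ sk_coord x b1 = 1,
      [/\ sk_coord x b4 = 0, sk_coord x b7 = 0 & sk_coord x b6 = 0] &
      [/\ sk_coord x b2 = 0, sk_coord x b5 = 0, sk_coord x c3 = 0
        & sk_coord x b8 = 0]].

Lemma normalized_expand x : normalized x ->
  exists (yb3 yb9 yc1 yc2 yc4 yc5 yd : K), x =
    e b1 + yb3 *: e b3 + yb9 *: e b9 + yc1 *: e c1 + yc2 *: e c2
      + yc4 *: e c4 + yc5 *: e c5 + yd *: e d.
Proof.
move=> [x1 [x4 x7 x6] [x2 x5 xc3 x8]].
exists (sk_coord x b3), (sk_coord x b9), (sk_coord x c1), (sk_coord x c2).
exists (sk_coord x c4), (sk_coord x c5), (sk_coord x d).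
rewrite -{1}[x]sk_of_coord !sk_ofE; apply: eq_sk_of => -[] /=;
by rewrite ?(x1, x2, x4, x5, x6, x7, x8, xc3); ring2.
Qed.

Lemma normalized_aut_id f :
  is_sk_aut f -> normalized (f (e b1)) -> f = \1%VF.
Proof.
move=> aut_f /normalized_expand[yb3 [yb9 [yc1 [yc2 [yc4 [yc5 [yd fb1]]]]]]].
have [_ fB] := aut_f.
have [u u0 fc2] := aut_c2 aut_f; have [w w0 fc4] := aut_c4 aut_f.
have nz (a b : K) : a != 0 -> a * b = 0 -> b = 0.
  by move=> a0 /eqP; rewrite mulf_eq0 (negbTE a0) => /eqP.
have nz2 (a b : K) : a != 0 -> a * b ^+ 2 = 0 -> b = 0.
  by move=> a0 /(nz _ _ a0)/eqP; rewrite expf_eq0 => /eqP.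
have fb2 : f (e b2) = w *: e b2 + (w * yc1) *: e c2.
  have <- : sk_bracket (e b1) (e c4) = e b2 by sk_calc.
  by rewrite fB fb1 fc4; sk_calc.
have fb3 : f (e b3) = (w * yb3) *: e b2 + w *: e b3
    + (w * yb9 + w * yc1 * yd) *: e b8 + (w * yb3 * yc1) *: e c2.
  have <- : sk_bracket (e b1) (e b2) = e b3 by sk_calc.
  by rewrite fB fb1 fb2; sk_calc.
have : sk_bracket (f (e b1)) (f (e b3)) = f (e b1).
  by rewrite -fB; congr (f _); sk_calc.
rewrite fb3 fb1 !(sk_ofE, sk_bracket_of) => /sk_of_inj E.
have w1 : w = 1 by read E b1.
have yb3_0 : yb3 = 0 by apply: (nz2 w) => //; read E b2.
have yd_0 : yd = 0 by read E d.
have yc4_0 : yc4 = 0 by read E c4.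
move: fb1 fc4; rewrite yb3_0 yd_0 yc4_0 w1 => fb1 fc4 {fb2 fb3 E}.
have fc3 : f (e c3) = u *: e c3.
  have <- : sk_bracket (e b1) (e c2) = e c3 by sk_calc.
  by rewrite fB fb1 fc2; sk_calc.
have fc1 : f (e c1) = u *: e c1 + (u * yc1) *: e b8 + (u * yb9) *: e c5.
  have <- : sk_bracket (e b1) (e c3) = e c1 by sk_calc.
  by rewrite fB fb1 fc3; sk_calc.
have fd : f (e d) = u *: e d + (u * yb9) *: e b5 + (u * yc1) *: e b9
    + (u * yc1 ^+ 2) *: e c5.
  have <- : sk_bracket (e b1) (e c1) = e d by sk_calc.
  by rewrite fB fb1 fc1; sk_calc.
have : sk_bracket (f (e b1)) (f (e d)) = 0.
  by rewrite -fB -(linear0 f); congr (f _); sk_calc.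
rewrite fd fb1 !(sk_ofE, sk_bracket_of) => /sk_of_inj E.
have yc1_0 : yc1 = 0 by apply: (nz2 u) => //; read E b5.
have yb9_0 : yb9 = 0 by apply: (nz2 u) => //; read E c2.
rewrite yc1_0 in E.
have yc2_0 : yc2 = 0 by apply: (nz u) => //; read E b8.
have yc5_0 : yc5 = 0 by apply: (nz u) => //; read E c4.
apply: aut_fixed_b1 => //; last by rewrite fc4 scale1r.
by rewrite fb1 yb9_0 yc1_0 yc2_0 yc5_0 !scale0r !addr0.
Qed.

(** * Reduction to normal form *)

(** The order of the generators matters: none of them disturbs a coordinate
    normalised by the earlier ones. *)
Lemma normalize (perfK : perfect_field K) x :
  sk_coord x b1 != 0 -> exists2 g, is_sk_aut0 g & normalized (g x).
Proof.
pose normalizable F := exists2 g, is_sk_aut0 g & normalized (g (sk_of F)).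
have step g F G : sk_generator g -> g (sk_of F) = sk_of G ->
    normalizable G -> normalizable F.
  move=> gen_g gF [h h0 nh]; exists (h \o g)%VF.
    exact: gen_comp h0 (gen_mem gen_g).
  by rewrite comp_lfunE /= gF.
have n8 F : F b1 = 1 -> F b4 = 0 -> F b7 = 0 -> F b6 = 0 -> F b2 = 0 ->
    F b5 = 0 -> F c3 = 0 -> F b8 = 0 -> normalizable F.
  by exists \1%VF; [exact: gen_id | rewrite id_lfunE /normalized !sk_coord_of].
have n7 F : F b1 = 1 -> F b4 = 0 -> F b7 = 0 -> F b6 = 0 -> F b2 = 0 ->
    F b5 = 0 -> F c3 = 0 -> normalizable F.
  move=> F1 F4 F7 F6 F2 F5 Fc3.
  apply: step (gen_exp_c3_sq (F b8)) (exp_c3_sq_of _ _) _.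
  by apply: n8 => /=; rewrite ?(F1, F4, F7, F6, F2, F5, Fc3); ring2.
have n6 F : F b1 = 1 -> F b4 = 0 -> F b7 = 0 -> F b6 = 0 -> F b2 = 0 ->
    F b5 = 0 -> normalizable F.
  move=> F1 F4 F7 F6 F2 F5.
  apply: step (gen_exp_c2 (F c3)) (exp_c2_of _ _) _.
  by apply: n7 => /=; rewrite ?(F1, F4, F7, F6, F2, F5); ring2.
have n5 F : F b1 = 1 -> F b4 = 0 -> F b7 = 0 -> F b6 = 0 -> F b2 = 0 ->
    normalizable F.
  move=> F1 F4 F7 F6 F2.
  apply: step (gen_exp_c5 (F b5)) (exp_c5_of _ _) _.
  by apply: n6 => /=; rewrite ?(F1, F4, F7, F6, F2); ring2.
have n4 F : F b1 = 1 -> F b4 = 0 -> F b7 = 0 -> F b6 = 0 -> normalizable F.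
  move=> F1 F4 F7 F6.
  apply: step (gen_exp_c4 (F b2)) (exp_c4_of _ _) _.
  by apply: n5 => /=; rewrite ?(F1, F4, F7, F6); ring2.
have n3 F : F b1 = 1 -> F b4 = 0 -> F b7 = 0 -> normalizable F.
  move=> F1 F4 F7; apply: step (gen_Psi (F b6)) (Psi_of _ _) _.
  by apply: n4 => /=; rewrite ?(F1, F4, F7); ring2.
have n2 F : F b1 = 1 -> F b4 = 0 -> normalizable F.
  move=> F1 F4; apply: step (gen_Theta (F b7)) (Theta_of _ _) _.
  by apply: n3 => /=; rewrite ?(F1, F4); ring2.
have n1 F : F b1 = 1 -> normalizable F.
  move=> F1; apply: step (gen_Phi (F b4)) (Phi_of _ _) _.
  by apply: n2 => /=; rewrite ?F1; ring2.
rewrite -[x]sk_of_coord sk_coord_of; move: (sk_coord x) => F F1.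
have [l l2] := perfK _ charK (F b1); rewrite pFrobenius_autE in l2.
have l0 : l != 0 by move: F1; rewrite -l2 expf_eq0.
apply: step (gen_Delta l0) (Delta_of _ _) _.
by apply: n1 => /=; rewrite -l2 mulVf // expf_neq0.
Qed.

Lemma aut_aut0 (perfK : perfect_field K) f : is_sk_aut f -> is_sk_aut0 f.
Proof.
move=> aut_f; have [g g0 ng] := normalize perfK (aut_b1_pivot aut_f).
have aut_g := sk_aut0_aut g0; have [gK _] := sk_autK aut_g.
have gf : (g \o f)%VF = \1%VF.
  by apply: normalized_aut_id (sk_aut_comp aut_g aut_f) _; rewrite comp_lfunE.
suff -> : f = (g^-1)%VF by exact: gen_inv.
by apply/lfunP => x; rewrite -[f x]gK -[g (f x)]comp_lfunE gf id_lfunE.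
Qed.

End SkryabinAutomorphisms.

Theorem theorem3 (K : fieldType) (charK : 2%N \in [pchar K])
    (perfK : perfect_field K) (quadK : quadratically_closed K)
    (f : 'End(skryabin K)) :
  is_sk_aut f <-> is_sk_aut0 f.
Proof.
split; [exact: aut_aut0 | exact: sk_aut0_aut].
Qed.
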